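(* Let $p,q,g:(a,b)\to\mathbb{R}$ be $F$-continuous. Let $F_*$ be any solution of the nonhomogeneous fractal differential equation $$D_x^{2\alpha}f(x)+p(x)D_x^{\alpha}f(x)+q(x)f(x)=g(x),$$ and let $f_1,f_2$ be a fundamental set of solutions of the corresponding homogeneous equation $$D_x^{2\alpha}f(x)+p(x)D_x^{\alpha}f(x)+q(x)f(x)=0.$$ Then the general solution of the nonhomogeneous equation can be represented in the form $$f(x)=c_1f_1(x)+c_2f_2(x)+F_*(x),$$ where $c_1,c_2$ are arbitrary constants.
   Context: Let $0<\alpha\le 1$, $F\subset\mathbb{R}$, and $(a,b)$ an open interval. For an interval $I$ put $\rho(F,I)=1$ if $F\cap I\ne\emptyset$ and $0$ otherwise. For $u<v$ and $\delta>0$ let $\gamma^\alpha_\delta(F,u,v)=\inf\sum_{i=0}^{n-1}\Gamma(\alpha+1)(t_{i+1}-t_i)^\alpha\rho(F,[t_i,t_{i+1}])$, the infimum over subdivisions $u=t_0<\dots<t_n=v$ with $\max_i(t_{i+1}-t_i)\le\delta$; $\gamma^\alpha(F,u,v)=\lim_{\delta\to0}\gamma^\alpha_\delta(F,u,v)$ (and $\gamma^\alpha(F,u,u)=0$). Fix $a_0\in\mathbb{R}$. The integral staircase function is $S_F^\alpha(x)=\gamma^\alpha(F,a_0,x)$ if $x\ge a_0$ and $S_F^\alpha(x)=-\gamma^\alpha(F,x,a_0)$ otherwise. $F$ is $\alpha$-perfect: $S_F^\alpha$ is finite on $\mathbb{R}$, $F$ is closed with no isolated points, and $F$ is exactly the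 set of points $x$ such that $S_F^\alpha$ is not constant on any open interval containing $x$. For $x\in F$, $\mathrm{F\text{-}lim}_{y\to x}h(y)=\ell$ means: for every $\varepsilon>0$ there is $\delta>0$ with $|h(y)-\ell|<\varepsilon$ for all $y\in F$ with $0<|y-x|<\delta$. A function $h$ is $F$-continuous in $(a,b)$ if $\mathrm{F\text{-}lim}_{y\to x}h(y)=h(x)$ for all $x\in F\cap(a,b)$. The $F^\alpha$-derivative of $f:(a,b)\to\mathbb{R}$ is $D_x^\alpha f(x)=\mathrm{F\text{-}lim}_{y\to x}\frac{f(y)-f(x)}{S_F^\alpha(y)-S_F^\alpha(x)}$ if $x\in F$ (when the limit exists), and $0$ if $x\notin F$; $D_x^{2\alpha}f=D_x^\alpha(D_x^\alpha f)$. $C^{n,\alpha}(a,b)$ is the set of $f:(a,b)\to\mathbb{R}$ that are $n$ times $F^\alpha$-differentiable at every point of $F\cap(a,b)$. A solution of a second $\alpha$-order equation is a function in $C^{2,\alpha}(a,b)$ satisfying the equation at all points of $F\cap(a,b)$; functions are compared on $F\cap(a,b)$. A fundamental set of solutions of the homogeneous equation is a pair of linearly independent solutions $f_1,f_2$ such that every solution is of the form $c_1f_1+c_2f_2$ with constants $c_1,c_2$. ''General solution'' means: the functions of the displayed form are solutions for all constants, and every solution is of this form for some constants. *)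

(* Defs.v *)
From HB Require Import structures.
From mathcomp Require Export all_boot all_order all_algebra.
From mathcomp Require Export all_classical all_reals all_analysis.
Export Order.TTheory GRing.Theory Num.Theory.
Export numFieldNormedType.Exports.

Set Implicit Arguments.
Unset Strict Implicit.
Unset Printing Implicit Defensive.

Local Open Scope classical_set_scope.
Local Open Scope ring_scope.

(* Functions on the open interval (a, b) are represented by total functions
   R -> R of which only the values on (a, b) matter: everything below is
   evaluated at points of F `&` (a, b), where F-limits are local. *)

Definition Gamma (R : realType) (z : R) : R :=
  \int[lebesgue_measure]_(t in `]0, +oo[) (t `^ (z - 1) * expR (- t)).

Definition rho (R : realType) (F I : set R) : R :=
  (`[< F `&` I !=set0 >])%:R.

(* A subdivision u = t_0 < ... < t_n = v is encoded by s = [:: t_1; ...; t_n],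
   and t_i = nth v (u :: s) i. *)
Definition mesh_le (R : realType) (delta u v : R) (s : seq R) : Prop :=
  forall i, (i < size s)%N -> s`_i - nth v (u :: s) i <= delta.

Definition coarse_sum (R : realType) (alpha : R) (F : set R) (u v : R)
    (s : seq R) : R :=
  let t := nth v (u :: s) in
  \sum_(0 <= i < size s)
    Gamma (alpha + 1) * (t i.+1 - t i) `^ alpha * rho F `[t i, t i.+1].

Definition coarse_mass (R : realType) (alpha : R) (F : set R)
    (u v delta : R) : \bar R :=
  ereal_inf [set (coarse_sum alpha F u v s)%:E |
             s in [set s | itv_partition u v s /\ mesh_le delta u v s]].

Definition mass (R : realType) (alpha : R) (F : set R) (u v : R) : \bar R :=
  if u < v then lim (coarse_mass alpha F u v delta @[delta --> 0^'+])
  else 0%E.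

(* Extended-real valued: finiteness is part of alpha-perfectness. *)
Definition staircase (R : realType) (alpha : R) (F : set R) (a0 x : R)
  : \bar R :=
  if a0 <= x then mass alpha F a0 x else (- mass alpha F x a0)%E.

Definition alpha_perfect (R : realType) (alpha : R) (F : set R) (a0 : R)
  : Prop :=
  [/\ forall x, staircase alpha F a0 x \is a fin_num,
      closed F,
      isolated F = set0
    & F = [set x | forall u v, u < x < v ->
             ~ exists c, forall y, u < y < v -> staircase alpha F a0 y = c]].

(* [h @ F_nbhs F x --> l] is F-lim_{y -> x} h(y) = l. *)
Definition F_nbhs (R : realType) (F : set R) (x : R) : set_system R :=
  within F x^'.

#[global] Instance F_nbhs_filter (R : realType) (F : set R) (x : R) :
  Filter (F_nbhs F x).
Proof. exact: within_filter. Qed.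

Definition oitv (R : realType) (a b : \bar R) : set R :=
  [set x | (a < x%:E < b)%E].

Definition F_continuous (R : realType) (F : set R) (a b : \bar R)
    (h : R -> R) : Prop :=
  forall x, (F `&` oitv a b) x -> h @ F_nbhs F x --> h x.

Section Falpha_derivative.
Variables (R : realType) (alpha : R) (F : set R) (a0 : R).

Definition Fquot (f : R -> R) (x y : R) : R :=
  (f y - f x) /
  (fine (staircase alpha F a0 y) - fine (staircase alpha F a0 x)).

Definition Fderivable (f : R -> R) (x : R) : Prop :=
  cvg (Fquot f x y @[y --> F_nbhs F x]).

(* Meaningful at x \in F only when [Fderivable f x]. *)
Definition Fderive (f : R -> R) (x : R) : R :=
  if x \in F then lim (Fquot f x y @[y --> F_nbhs F x]) else 0.

Definition C_Falpha (n : nat) (a b : \bar R) (f : R -> R) : Prop :=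
  forall k, (k < n)%N ->
  forall x, (F `&` oitv a b) x -> Fderivable (iter k Fderive f) x.

Definition solution (a b : \bar R) (p q g f : R -> R) : Prop :=
  C_Falpha 2 a b f /\
  forall x, (F `&` oitv a b) x ->
    Fderive (Fderive f) x + p x * Fderive f x + q x * f x = g x.

Definition lin_indep (a b : \bar R) (f1 f2 : R -> R) : Prop :=
  forall c1 c2 : R,
    (forall x, (F `&` oitv a b) x -> c1 * f1 x + c2 * f2 x = 0) ->
    c1 = 0 /\ c2 = 0.

Definition fundamental_set (a b : \bar R) (p q f1 f2 : R -> R) : Prop :=
  [/\ solution a b p q (cst 0) f1,
      solution a b p q (cst 0) f2,
      lin_indep a b f1 f2
    & forall f, solution a b p q (cst 0) f ->
        exists c1 c2 : R, forall x, (F `&` oitv a b) x ->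
          f x = c1 * f1 x + c2 * f2 x].

End Falpha_derivative.

(* Main.v *)
From mathcomp Require Import ring.
Require Import Defs.

(* D^alpha is a limit along the filter [F_nbhs F x], which is proper because F
   has no isolated points, so it is linear.  It is also local on F, so that
   derivatives known to agree only on F `&` (a, b) can be differentiated again.
   Hence solutions satisfy the superposition principle, and the difference of
   two solutions of the nonhomogeneous equation solves the homogeneous one. *)

Set Implicit Arguments.
Unset Strict Implicit.

Local Open Scope classical_set_scope.
Local Open Scope ring_scope.

Lemma F_nbhs_proper (R : realType) (F : set R) (x : R) :
  isolated F = set0 -> F x -> ProperFilter (F_nbhs F x).
Proof.
move=> isoF Fx; apply: Build_ProperFilter_ex => A nA.
have [//|nex] := pselect (exists y, A y).
suff : isolated F x by rewrite isoF.
split; first exact/mem_set.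
(* Unfolding [F_nbhs], that [A] belongs to the filter says exactly that this set is a neighbourhood
   of [x]. As [A] is empty, it meets [F] only at [x]. *)
exists [set y | y != x -> F y -> A y]; first exact: nA.
apply/seteqP; split => [y [Vy Fy]|y ->]; last by split => //= /eqP.
by apply/eqP/negPn/negP => yx; apply: nex; exists y; exact: Vy.
Qed.

Lemma oitv_open (R : realType) (a b : \bar R) : open (oitv a b).
Proof.
have -> : oitv a b = [set x | (a < x%:E)%E] `&` [set x | (x%:E < b)%E].
  by apply/seteqP; split => x; [move=> /andP[] | move=> [ax xb]; exact/andP].
by apply: openI; [exact: open_ereal_gt | exact: open_ereal_lt].
Qed.

Section superposition.
Variables (R : realType) (alpha : R) (F : set R) (a0 : R) (a b : \bar R).
Hypothesis isoF : isolated F = set0.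
Let D := Fderive alpha F a0.

Lemma cvg_Fderive (f : R -> R) (x l : R) : F x ->
  Fquot alpha F a0 f x y @[y --> F_nbhs F x] --> l -> D f x = l.
Proof.
move=> Fx fl; rewrite /D /Fderive mem_set//.
by apply: cvg_lim => //; exact: F_nbhs_proper.
Qed.

Lemma Fquot_cvg_comb (c : R) (f h : R -> R) (x : R) : F x ->
  Fderivable alpha F a0 f x -> Fderivable alpha F a0 h x ->
  Fquot alpha F a0 (fun y => c * f y + h y) x y @[y --> F_nbhs F x]
    --> c * D f x + D h x.
Proof.
rewrite /D /Fderive => Fx df dh; rewrite mem_set//.
have -> : Fquot alpha F a0 (fun y => c * f y + h y) x =
    (fun y => c * Fquot alpha F a0 f x y + Fquot alpha F a0 h x y).
  (* No case split on a vanishing staircase increment: its inverse is a common factor, whatever its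
     value. *)
  by apply/funext => y; rewrite /Fquot; ring.
by apply: cvgD; [apply: cvgM; [exact: cvg_cst | exact: df] | exact: dh].
Qed.

(** Since [oitv a b] is open, points of [F] near [x] lie in it, so there the two quotients have
    equal numerators; the base point [x] lies in it as well. *)
Lemma Fquot_cvg_eq_in (f h : R -> R) (x l : R) : (F `&` oitv a b) x ->
  {in F `&` oitv a b, f =1 h} ->
  Fquot alpha F a0 f x y @[y --> F_nbhs F x] --> l ->
  Fquot alpha F a0 h x y @[y --> F_nbhs F x] --> l.
Proof.
move=> [Fx abx] fh; apply: cvg_trans; apply: near_eq_cvg.
have : nbhs x (oitv a b) by apply: open_nbhs_nbhs; split => //; exact: oitv_open.
move=> nab; apply: (filterS _ nab) => y aby _ Fy.
by rewrite /Fquot !fh //; apply/mem_set.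
Qed.

(** A single scalar suffices: iterating gives any linear combination, and [c = -1] gives
    differences. Letting the right-hand sides vary covers both equations at once. *)
Lemma solution_comb (p q g h f k : R -> R) (c : R) :
  solution alpha F a0 a b p q g f -> solution alpha F a0 a b p q h k ->
  solution alpha F a0 a b p q (fun x => c * g x + h x)
    (fun x => c * f x + k x).
Proof.
move=> [df ef] [dk ek]; pose u x := c * f x + k x.
have cvg1 x (Fx : (F `&` oitv a b) x) :
    Fquot alpha F a0 u x y @[y --> F_nbhs F x] --> c * D f x + D k x.
  exact: Fquot_cvg_comb Fx.1 (df 0%N isT x Fx) (dk 0%N isT x Fx).
have D1 x (Fx : (F `&` oitv a b) x) : D u x = c * D f x + D k x
  := cvg_Fderive Fx.1 (cvg1 x Fx).
have cvg2 x (Fx : (F `&` oitv a b) x) :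
    Fquot alpha F a0 (D u) x y @[y --> F_nbhs F x]
      --> c * D (D f) x + D (D k) x.
  (* [D1] identifies [D u] only on [F] inside the interval, so the limit is computed for the
     explicit combination and then transferred to [D u]. *)
  apply: (Fquot_cvg_eq_in Fx (f := fun y => c * D f y + D k y)) => [y|].
    by move/set_mem => /D1.
  exact: Fquot_cvg_comb Fx.1 (df 1%N isT x Fx) (dk 1%N isT x Fx).
split=> [[|[|//]] _ x Fx|x Fx].
- by apply/cvg_ex; eexists; exact: cvg1 Fx.
- by apply/cvg_ex; eexists; exact: cvg2 Fx.
- rewrite -ef// -ek// -!/D D1// (cvg_Fderive Fx.1 (cvg2 x Fx)) /u -/D.
  ring.
Qed.

Lemma solution_homogeneous_comb (p q g f1 f2 f : R -> R) (c1 c2 : R) :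
  solution alpha F a0 a b p q (cst 0) f1 ->
  solution alpha F a0 a b p q (cst 0) f2 ->
  solution alpha F a0 a b p q g f ->
  solution alpha F a0 a b p q g (fun x => c1 * f1 x + c2 * f2 x + f x).
Proof.
(* The right-hand side obtained is [c1 * 0 + (c2 * 0 + g x)], which reduces to [g x]. *)
move=> s1 s2 s; have := solution_comb c1 s1 (solution_comb c2 s2 s).
congr (solution _ _ _ _ _ _ _ _ _); apply/funext => x /=; last by rewrite addrA.
by rewrite !mulr0 !add0r.
Qed.

Lemma solution_sub (p q g f h : R -> R) :
  solution alpha F a0 a b p q g f -> solution alpha F a0 a b p q g h ->
  solution alpha F a0 a b p q (cst 0) (fun x => f x - h x).
Proof.
move=> sf sh; have := solution_comb (-1) sh sf.
by congr (solution _ _ _ _ _ _ _ _ _); apply/funext => x /=; ring.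
Qed.

End superposition.

Theorem theorem8 (R : realType) (alpha : R) (F : set R) (a0 : R)
    (a b : \bar R) (p q g Fs f1 f2 : R -> R)
    (halpha : 0 < alpha <= 1)
    (hF : alpha_perfect alpha F a0)
    (hab : (a < b)%E)
    (hp : F_continuous F a b p)
    (hq : F_continuous F a b q)
    (hg : F_continuous F a b g)
    (hFs : solution alpha F a0 a b p q g Fs)
    (hf : fundamental_set alpha F a0 a b p q f1 f2) :
  (forall c1 c2 : R,
     solution alpha F a0 a b p q g (fun x => c1 * f1 x + c2 * f2 x + Fs x)) /\
  (forall f : R -> R, solution alpha F a0 a b p q g f ->
     exists c1 c2 : R, forall x, (F `&` oitv a b) x ->
       f x = c1 * f1 x + c2 * f2 x + Fs x).
Proof.
have [_ _ isoF _] := hF; have [s1 s2 _ span] := hf.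
split=> [c1 c2|f sf]; first exact: solution_homogeneous_comb.
have [c1 [c2 fE]] := span _ (solution_sub isoF sf hFs).
by exists c1, c2 => x /fE <-; rewrite subrK.
Qed.
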